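(* For all problems $f,g$: if $f\le_{\mathrm W}g$, then $f^\infty\le_{\mathrm{sW}}g^\infty$.
   Context: Problems. A represented space $(X,\delta_X)$ is a set $X$ with a surjective partial map $\delta_X:\subseteq\mathbb N^{\mathbb N}\to X$. A partial function $F:\subseteq\mathbb N^{\mathbb N}\to\mathbb N^{\mathbb N}$ is computable if there is a computable monotone (w.r.t. the prefix order) word function $\varphi:\mathbb N^*\to\mathbb N^*$ with $F(p)=\sup_{w\sqsubseteq p}\varphi(w)$ for all $p\in\mathrm{dom}(F)$. For a partial multivalued function $f:\subseteq X\rightrightarrows Y$ between represented spaces, $F:\subseteq\mathbb N^{\mathbb N}\to\mathbb N^{\mathbb N}$ is a realizer of $f$, written $F\vdash f$, if $\delta_YF(p)\in f\delta_X(p)$ for all $p\in\mathrm{dom}(f\delta_X)$. A problem is a multivalued function with a realizer. Composition: $g\circ f(x)=\{z:(\exists y\in f(x))\,z\in g(y)\}$ with $\mathrm{dom}(g\circ f)=\{x\in\mathrm{dom}(f):f(x)\subseteq\mathrm{dom}(g)\}$. The realizer version of $f$ is $f^{\mathrm r}:=\delta_Y^{-1}\circ f\circ\delta_X:\subseteq\mathbb N^{\mathbb N}\rightrightarrows\mathbb N^{\mathbb N}$. Tupling. $\langle q,p\rangle:=q(0)p(0)q(1)p(1)\dots$, and $\langle p_0,p_1,p_2,\dots\rangle$ is the standard countable tupling, e.g. $\langle p_0,p_1,\dots\rangle(\langle i,j\rangle)=p_i(j)$. $\langle\mathrm{id}\times f\rangle$ is the problem $\langle q,p\rangle\mapsto\{\langle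 q,r\rangle:r\in f(p)\}$. Universal function. $\Phi$ is a fixed standard total representation of a set of continuous partial functions on $\mathbb N^{\mathbb N}$ (with natural domains), where a name $q$ encodes the graph of a monotone word function approximating $\Phi_q$; $\mathsf U_q:=\Phi_q$, and $\mathsf U\langle q,p\rangle:=\mathsf U_q(p)$ is a computable partial function. The smn-theorem holds: for every computable (continuous) $F:\subseteq\mathbb N^{\mathbb N}\to\mathbb N^{\mathbb N}$ there is a total computable (continuous) $S$ with $\mathsf U_{S(q)}(p)=F\langle q,p\rangle$ for all $\langle q,p\rangle\in\mathrm{dom}(F)$. The names $q$ allow the digits $0,1,2$ as dummy symbols: adding or removing them does not change $\mathsf U_q$. Infinite loop. For a problem $f:\subseteq\mathbb N^{\mathbb N}\rightrightarrows\mathbb N^{\mathbb N}$, $f^\infty(q_0):=\{\langle q_0,q_1,q_2,\dots\rangle:(\forall i)\ q_{i+1}\in\mathsf U\circ\langle\mathrm{id}\times f\rangle(q_i)\}$, with $\mathrm{dom}(f^\infty)$ the set of all $q_0$ such that $A_0:=\{q_0\}\subseteq\mathrm{dom}(\mathsf U\circ\langle\mathrm{id}\times f\rangle)$ and $A_{i+1}:=\mathsf U\circ\langle\mathrm{id}\times f\rangle(A_i)\subseteq\mathrm{dom}(\mathsf U\circ\langle\mathrm{id}\times f\rangle)$ for all $i$. For arbitrary $f$, $f^\infty:=(f^{\mathrm r})^\infty$. Reducibilities. $f\le_{\mathrm W}g$ (Weihrauch reducible) if there are computable $H,K:\subseteq\mathbb N^{\mathbb N}\to\mathbb N^{\mathbb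 N}$ with $H\langle\mathrm{id},GK\rangle\vdash f$ whenever $G\vdash g$; $f\le_{\mathrm{sW}}g$ (strongly Weihrauch reducible) if there are computable $H,K$ with $HGK\vdash f$ whenever $G\vdash g$. *)

(* Defs.v *)
From Stdlib Require Cantor.
From mathcomp Require Import all_boot.
From mathcomp Require Import boolp classical_sets.

Set Implicit Arguments.
Unset Strict Implicit.
Unset Printing Implicit Defensive.

Local Open Scope classical_set_scope.

Definition word := seq nat.
Definition baire := nat -> nat.

(* Total recursive functions: the least class containing the initial functions
   and closed under composition, primitive recursion and minimization of regular
   functions, i.e. of functions for which the minimum always exists. By Kleene's
   normal form theorem these are exactly the total computable functions. *)
Inductive recursive : forall n, (n.-tuple nat -> nat) -> Prop :=
| rec_zero n : recursive (fun _ : n.-tuple nat => 0)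
| rec_succ : recursive (fun x : 1.-tuple nat => (thead x).+1)
| rec_proj n (i : 'I_n) : recursive (fun x : n.-tuple nat => tnth x i)
| rec_comp m n (g : m.-tuple nat -> nat) (h : 'I_m -> n.-tuple nat -> nat) :
    recursive g -> (forall i, recursive (h i)) ->
    recursive (fun x : n.-tuple nat => g [tuple h i x | i < m])
| rec_primrec n (g : n.-tuple nat -> nat) (h : n.+2.-tuple nat -> nat) :
    recursive g -> recursive h ->
    recursive (fun x : n.+1.-tuple nat =>
      iteri (thead x)
        (fun k y => h [tuple of k :: y :: behead_tuple x])
        (g (behead_tuple x)))
| rec_min n (f : n.+1.-tuple nat -> nat)
    (f_regular : forall x : n.-tuple nat, exists k, f [tuple of k :: x] == 0) :
    recursive f ->
    recursive (fun x : n.-tuple nat => ex_minn (f_regular x)).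

(* [CodeSeq.code] and [CodeSeq.decode] are mutually inverse bijections between
   words and natural numbers. *)
Definition computable_word_function (phi : word -> word) : Prop :=
  recursive (fun x : 1.-tuple nat =>
    CodeSeq.code (phi (CodeSeq.decode (thead x)))).

Definition word_monotone (phi : word -> word) : Prop :=
  {homo phi : u v / prefix u v}.

Definition initial (w : word) (p : baire) : Prop := w = mkseq p (size w).

(* [r] is the supremum of the set of words [A] in the prefix order on finite
   and infinite sequences; as [r] is infinite, the words of [A] must have
   unbounded lengths. *)
Definition is_sup (A : set word) (r : baire) : Prop :=
  (forall w, A w -> initial w r) /\ (forall n, exists2 w, A w & n <= size w).

Lemma is_sup_unique (A : set word) (r s : baire) :
  is_sup A r -> is_sup A s -> r = s.
Proof.
move=> [Ar Ur] [As _]; apply: funext => n.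
have [w Aw lt_nw] := Ur n.+1.
by rewrite -(nth_mkseq 0 r lt_nw) -(nth_mkseq 0 s lt_nw) -(Ar w Aw) -(As w Aw).
Qed.

(* Single-valued partial functions are option-valued, [None] meaning
   "undefined"; they compose by [pcomp]. *)
Definition computable (F : baire -> option baire) : Prop :=
  exists phi : word -> word,
    [/\ computable_word_function phi, word_monotone phi &
        forall p r, F p = Some r -> is_sup (phi @` [set w | initial w p]) r].

Record representedSpace := RepresentedSpace {
  carrier :> Type;
  delta : baire -> option carrier;
  delta_surjective : forall x, exists p, delta p = Some x
}.

Lemma Some_surjective (p : baire) : exists q, Some q = Some p.
Proof. by exists p. Qed.

Definition baireSpace : representedSpace :=
  @RepresentedSpace baire Some Some_surjective.

(* A partial multivalued function is undefined where its value is empty. *)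
Definition multifun (X Y : Type) := X -> set Y.

Definition mdom (X Y : Type) (f : multifun X Y) : set X :=
  [set x | f x !=set0].

(* The inclusion [f x `<=` mdom g] makes the domain that of the composition of
   problems, which is smaller than that of relational composition. *)
Definition mcomp (X Y Z : Type) (g : multifun Y Z) (f : multifun X Y) :
    multifun X Z :=
  fun x => [set z | f x `<=` mdom g /\ exists2 y, f x y & g y z].

Definition graph (X Y : Type) (F : X -> option Y) : multifun X Y :=
  fun x => [set y | F x = Some y].

Definition minverse (X Y : Type) (f : multifun X Y) : multifun Y X :=
  fun y => [set x | f x y].

Definition realizes (X Y : representedSpace)
    (F : baire -> option baire) (f : multifun X Y) : Prop :=
  forall p, mdom (mcomp f (graph (@delta X))) p ->
    exists2 y, pcomp (@delta Y) F p = Some y & mcomp f (graph (@delta X)) p y.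

Definition problem (X Y : representedSpace) (f : multifun X Y) : Prop :=
  exists F, realizes F f.

Definition realizer_version (X Y : representedSpace) (f : multifun X Y) :
    multifun baire baire :=
  mcomp (minverse (graph (@delta Y))) (mcomp f (graph (@delta X))).

Definition pairing (q p : baire) : baire :=
  fun n => if odd n then p n./2 else q n./2.

Definition tupling (p : nat -> baire) : baire :=
  fun n => let: (i, j) := Cantor.of_nat n in p i j.

Definition id_times (f : multifun baire baire) : multifun baire baire :=
  fun x => [set y | exists q p r, [/\ x = pairing q p, f p r & y = pairing q r]].

(* The symbol encoding the pair of words [(u, v)]. This is a bijection between
   pairs of words and the symbols other than 0, 1, 2. *)
Definition graph_symbol (u v : word) : nat :=
  3 + Cantor.to_nat (CodeSeq.code u, CodeSeq.code v).

Definition listed (q : baire) (u v : word) : Prop :=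
  exists k, q k = graph_symbol u v.

(* [q] lists, in any order and with arbitrary dummy symbols 0, 1, 2, the graph
   of a word function approximating [Phi q]. Every [q] is a name: if [q] lists
   incompatible words for prefixes of [p] then [p] is not in the domain of
   [Phi q]. (This is still a natural domain: freezing the output as soon as an
   incompatibility shows up gives a monotone word function for [Phi q].) *)
Definition Phi (q : baire) : multifun baire baire :=
  fun p => [set r | is_sup [set v | exists2 u, initial u p & listed q u v] r].

Lemma Phi_single_valued (q p r s : baire) : Phi q p r -> Phi q p s -> r = s.
Proof. exact: is_sup_unique. Qed.

Lemma Phi_dummy (q q' : baire) :
  (forall a, 3 <= a -> (exists k, q k = a) <-> (exists k, q' k = a)) ->
  Phi q = Phi q'.
Proof.
move=> qq'; have eqL : listed q = listed q'; last by rewrite /Phi eqL.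
apply: funext => u; apply: funext => v; apply: propext.
exact: qq' (leq_addr _ 3).
Qed.

Definition universal : multifun baire baire :=
  fun x => [set r | exists q p, x = pairing q p /\ Phi q p r].

Definition loop_step (f : multifun baire baire) : multifun baire baire :=
  mcomp universal (id_times f).

Fixpoint loop_stage (f : multifun baire baire) (q0 : baire) (i : nat) :
    set baire :=
  if i is j.+1 then \bigcup_(q in loop_stage f q0 j) loop_step f q
  else [set q0].

Definition loop_dom (f : multifun baire baire) : set baire :=
  [set q0 | forall i, loop_stage f q0 i `<=` mdom (loop_step f)].

Definition loop (f : multifun baire baire) : multifun baire baire :=
  fun q0 => [set r | loop_dom f q0 /\
    exists q : nat -> baire,
      [/\ q 0 = q0, forall i, loop_step f (q i) (q i.+1) & r = tupling q]].

Definition infinite_loop (X Y : representedSpace) (f : multifun X Y) :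
    multifun baireSpace baireSpace :=
  loop (realizer_version f).

(* The partial function [p |-> <p, F p>]. *)
Definition pair_id (F : baire -> option baire) : baire -> option baire :=
  fun p => omap (pairing p) (F p).

Definition weihrauch_reducible (X Y Z W : representedSpace)
    (f : multifun X Y) (g : multifun Z W) : Prop :=
  exists H K : baire -> option baire,
    [/\ computable H, computable K &
        forall G, realizes G g -> realizes (pcomp H (pair_id (pcomp G K))) f].

Definition strongly_weihrauch_reducible (X Y Z W : representedSpace)
    (f : multifun X Y) (g : multifun Z W) : Prop :=
  exists H K : baire -> option baire,
    [/\ computable H, computable K &
        forall G, realizes G g -> realizes (pcomp H (pcomp G K)) f].

(* Main.v *)
From Stdlib Require Cantor.
From mathcomp Require Import all_boot zify.
From mathcomp Require Import boolp classical_sets.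
Require Import Defs.

(* Let [H], [K] witness that [f] is reducible to [g]. A stage [q = <a, p>] of
   the loop of [f] is simulated by the stage [<S q, K p>] of the loop of [g],
   where [S q] names the function sending [s] to [<S q', K p'>] with
   [q' = <a', p'> = U_a (H <p, s>)]. Then the simulated stages of a run from
   [<S q0, K p0>] are exactly the lifts of a run from [q0]. The name [S q] also
   codes [q] in entries that do not affect the function it names, so that the
   run of [f] is read off the run of [g] alone, and the reduction is strong.

   [S] refers to itself. Instead of the recursion theorem, the symbols of all
   [S q] are written in one table indexed by coded pairs of a prefix of [q] and a
   position, where an entry only uses earlier entries; as the entries
   contain an arbitrary padding number, every needed one is eventually earlier. *)

Set Implicit Arguments.
Unset Strict Implicit.
Unset Printing Implicit Defensive.

Local Open Scope classical_set_scope.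

(** * Closure properties of the recursive functions *)

Definition recursive_word n (w : n.-tuple nat -> word) : Prop :=
  recursive (fun x => CodeSeq.code (w x)).

Definition recursive_bool n (b : n.-tuple nat -> bool) : Prop :=
  recursive (fun x => b x : nat).

Create HintDb recursion.

Lemma eq_recursive n (f g : n.-tuple nat -> nat) :
  f =1 g -> recursive f -> recursive g.
Proof. by move=> /funext ->. Qed.

Lemma recursive_tnth n (i : 'I_n) : recursive (fun x : n.-tuple nat => tnth x i).
Proof. exact: rec_proj. Qed.

Lemma recursive_thead n : recursive (fun x : n.+1.-tuple nat => thead x).
Proof. exact: rec_proj. Qed.

Lemma recursive_subst m n (f : m.-tuple nat -> nat)
    (t : n.-tuple nat -> m.-tuple nat) :
  recursive f -> (forall i, recursive (fun x => tnth (t x) i)) ->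
  recursive (fun x => f (t x)).
Proof.
move=> rf rt; apply: eq_recursive (rec_comp rf rt) => x; congr f.
by apply: eq_from_tnth => i; rewrite tnth_mktuple.
Qed.

Lemma recursive_behead n (f : n.-tuple nat -> nat) :
  recursive f -> recursive (fun x : n.+1.-tuple nat => f (behead_tuple x)).
Proof.
move=> rf; apply: (recursive_subst (t := @behead_tuple _ nat)) => // i.
apply: eq_recursive (recursive_tnth (inord i.+1)) => x.
by rewrite tnth_behead.
Qed.

Lemma recursive_subst_thead m n (F : nat -> n.-tuple nat -> nat)
    (a : m.-tuple nat -> nat) (t : m.-tuple nat -> n.-tuple nat) :
  recursive (fun z : n.+1.-tuple nat => F (thead z) (behead_tuple z)) ->
  recursive a -> (forall i, recursive (fun x => tnth (t x) i)) ->
  recursive (fun x => F (a x) (t x)).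
Proof.
move=> rF ra rt; pose at_ x := [tuple of a x :: t x].
have rat i : recursive (fun x => tnth (at_ x) i).
  case: (unliftP ord0 i) => [j|] ->; last exact: ra.
  by apply: eq_recursive (rt j) => x; rewrite tnthS.
apply: eq_recursive (recursive_subst rF rat) => x.
by rewrite /at_; congr F; exact: val_inj.
Qed.

Lemma recursive_cons n (f : n.+1.-tuple nat -> nat) (a : n.-tuple nat -> nat) :
  recursive f -> recursive a ->
  recursive (fun x => f [tuple of a x :: x]).
Proof.
move=> rf ra; apply: recursive_subst => // i.
case: (unliftP ord0 i) => [j|] ->; last exact: ra.
by apply: eq_recursive (recursive_tnth j) => x; rewrite tnthS.
Qed.

Lemma recursive_comp1 n (f : nat -> nat) (a : n.-tuple nat -> nat) :
  recursive (fun x : 1.-tuple nat => f (thead x)) -> recursive a ->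
  recursive (fun x => f (a x)).
Proof.
move=> rf ra; apply: eq_recursive (rec_comp (h := fun=> a) rf (fun=> ra)) => x.
by rewrite /thead tnth_mktuple.
Qed.

Lemma recursive_succ n (a : n.-tuple nat -> nat) :
  recursive a -> recursive (fun x => (a x).+1).
Proof. exact/recursive_comp1/rec_succ. Qed.

Lemma recursive_const n (c : nat) : recursive (fun _ : n.-tuple nat => c).
Proof. by elim: c => [|c IHc]; [exact: rec_zero | exact: recursive_succ]. Qed.

(** [rec_primrec] reads the number of rounds off the head of the argument tuple; putting [N x] in
    front of [x] allows any recursive bound. *)
Lemma recursive_iteri n (N g : n.-tuple nat -> nat) h :
  recursive N -> recursive g ->
  recursive (fun z : n.+2.-tuple nat =>
    h (thead z) (thead (behead_tuple z)) (behead_tuple (behead_tuple z))) ->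
  recursive (fun x => iteri (N x) (fun k y => h k y x) (g x)).
Proof.
move=> rN rg rh; have := recursive_cons (rec_primrec rg rh) rN.
apply: eq_recursive => x /=; rewrite theadE.
have eq_x : behead_tuple [tuple of N x :: x] = x by exact: val_inj.
rewrite [in g _]eq_x; apply: eq_iteri => k y.
by congr h; exact: val_inj.
Qed.

Lemma recursive_word_code n (w : n.-tuple nat -> word) :
  recursive_word w -> recursive (fun x => CodeSeq.code (w x)).
Proof. by []. Qed.

Lemma recursive_nat_of_bool n (b : n.-tuple nat -> bool) :
  recursive_bool b -> recursive (fun x => nat_of_bool (b x)).
Proof. by []. Qed.

Lemma recursive_word_decode n (a : n.-tuple nat -> nat) :
  recursive a -> recursive_word (fun x => CodeSeq.decode (a x)).
Proof. by apply: eq_recursive => x; rewrite CodeSeq.decodeK. Qed.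

Lemma recursive_word_const n (w : word) : recursive_word (fun _ : n.-tuple nat => w).
Proof. exact: recursive_const. Qed.

Lemma recursive_word_comp n (phi : word -> word) (w : n.-tuple nat -> word) :
  computable_word_function phi -> recursive_word w ->
  recursive_word (fun x => phi (w x)).
Proof.
move=> rphi rw; pose f c := CodeSeq.code (phi (CodeSeq.decode c)).
by apply: eq_recursive (@recursive_comp1 _ f _ rphi rw) => x; rewrite /f CodeSeq.codeK.
Qed.

#[export] Hint Resolve recursive_thead recursive_succ recursive_const recursive_word_code
  recursive_nat_of_bool recursive_word_decode recursive_word_const
  recursive_word_comp : recursion.

(* [auto] cannot guess how a hypothesis about an [n]-ary function applies below
   binders, that is, to an iterated tail of the argument tuple. *)
Ltac weaken H :=
  first [exact H | exact (recursive_behead H)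
        | exact (recursive_behead (recursive_behead H))
        | exact (recursive_behead (recursive_behead (recursive_behead H)))].

#[export] Hint Extern 0 (recursive (fun x => thead _)) =>
  weaken uconstr:(recursive_thead _) : recursion.
#[export] Hint Extern 0 (recursive (fun x => _ _)) =>
  match goal with
  | H : @recursive _ ?f |- @recursive _ (fun x => ?f _) => weaken H
  end : recursion.
#[export] Hint Extern 0 (recursive_word (fun x => _ _)) =>
  match goal with
  | H : @recursive_word _ ?f |- @recursive_word _ (fun x => ?f _) => weaken H
  end : recursion.
#[export] Hint Extern 0 (recursive_bool (fun x => _ _)) =>
  match goal with
  | H : @recursive_bool _ ?f |- @recursive_bool _ (fun x => ?f _) => weaken H
  end : recursion.

Ltac recursion := solve [auto 100 with recursion nocore].

Lemma recursive_predn n (a : n.-tuple nat -> nat) :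
  recursive a -> recursive (fun x => (a x).-1).
Proof.
move=> ra; have := @recursive_iteri _ a (fun=> 0) (fun k y x => k) ra.
move=> /(_ ltac:(recursion) ltac:(recursion)); apply: eq_recursive => x.
by case: (a x).
Qed.
#[export] Hint Resolve recursive_predn : recursion.

Lemma recursive_addn n (a b : n.-tuple nat -> nat) :
  recursive a -> recursive b -> recursive (fun x => a x + b x).
Proof.
move=> ra rb; have := @recursive_iteri _ a b (fun k y x => y.+1) ra rb.
move=> /(_ ltac:(recursion)); apply: eq_recursive => x.
by elim: (a x) => //= k ->.
Qed.

Lemma recursive_subn n (a b : n.-tuple nat -> nat) :
  recursive a -> recursive b -> recursive (fun x => a x - b x).
Proof.
move=> ra rb; have := @recursive_iteri _ b a (fun k y x => y.-1) rb ra.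
move=> /(_ ltac:(recursion)); apply: eq_recursive => x.
by elim: (b x) => /= [|k ->]; rewrite ?subn0 // subnS.
Qed.
#[export] Hint Resolve recursive_addn recursive_subn : recursion.

Lemma recursive_muln n (a b : n.-tuple nat -> nat) :
  recursive a -> recursive b -> recursive (fun x => a x * b x).
Proof.
move=> ra rb; have := @recursive_iteri _ a (fun=> 0) (fun k y x => b x + y) ra.
move=> /(_ ltac:(recursion) ltac:(recursion)); apply: eq_recursive => x.
by elim: (a x) => //= k ->.
Qed.
#[export] Hint Resolve recursive_muln : recursion.

Lemma recursive_expn n (a b : n.-tuple nat -> nat) :
  recursive a -> recursive b -> recursive (fun x => a x ^ b x).
Proof.
move=> ra rb; have := @recursive_iteri _ b (fun=> 1) (fun k y x => a x * y) rb.
move=> /(_ ltac:(recursion) ltac:(recursion)); apply: eq_recursive => x.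
by elim: (b x) => //= k ->; rewrite expnS.
Qed.

Lemma recursive_double n (a : n.-tuple nat -> nat) :
  recursive a -> recursive (fun x => (a x).*2).
Proof.
move=> ra; have : recursive (fun x => a x + a x) by recursion.
by apply: eq_recursive => x; rewrite addnn.
Qed.

Lemma recursive_bool_leq n (a b : n.-tuple nat -> nat) :
  recursive a -> recursive b -> recursive_bool (fun x => a x <= b x).
Proof.
move=> ra rb; have : recursive (fun x => 1 - (a x - b x)) by recursion.
by apply: eq_recursive => x; rewrite /leq; case: (a x - b x).
Qed.

Lemma recursive_bool_and n (b c : n.-tuple nat -> bool) :
  recursive_bool b -> recursive_bool c -> recursive_bool (fun x => b x && c x).
Proof.
move=> rb rc; have : recursive (fun x => b x * c x) by recursion.
by apply: eq_recursive => x; rewrite mulnb.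
Qed.

Lemma recursive_bool_not n (b : n.-tuple nat -> bool) :
  recursive_bool b -> recursive_bool (fun x => ~~ b x).
Proof.
move=> rb; have : recursive (fun x => 1 - b x) by recursion.
by apply: eq_recursive => x; case: (b x).
Qed.
#[export] Hint Resolve recursive_expn recursive_double recursive_bool_leq
  recursive_bool_and recursive_bool_not : recursion.

Lemma recursive_bool_eqn n (a b : n.-tuple nat -> nat) :
  recursive a -> recursive b -> recursive_bool (fun x => a x == b x).
Proof.
move=> ra rb; have : recursive_bool (fun x => (a x <= b x) && (b x <= a x)) by recursion.
by apply: eq_recursive => x; rewrite eqn_leq.
Qed.

Lemma recursive_if n (b : n.-tuple nat -> bool) (f g : n.-tuple nat -> nat) :
  recursive_bool b -> recursive f -> recursive g ->
  recursive (fun x => if b x then f x else g x).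
Proof.
move=> rb rf rg; have : recursive (fun x => b x * f x + ~~ b x * g x) by recursion.
by apply: eq_recursive => x; case: (b x); rewrite ?mul0n ?mul1n ?addn0.
Qed.

Lemma recursive_word_if n (b : n.-tuple nat -> bool) (f g : n.-tuple nat -> word) :
  recursive_bool b -> recursive_word f -> recursive_word g ->
  recursive_word (fun x => if b x then f x else g x).
Proof.
move=> rb rf rg; apply: eq_recursive (recursive_if rb rf rg) => x.
by case: (b x).
Qed.
#[export] Hint Resolve recursive_bool_eqn recursive_if recursive_word_if : recursion.

Lemma recursive_bool_odd n (a : n.-tuple nat -> nat) :
  recursive a -> recursive_bool (fun x => odd (a x)).
Proof.
move=> ra; have := @recursive_iteri _ a (fun=> 0) (fun k y x => 1 - y) ra.
move=> /(_ ltac:(recursion) ltac:(recursion)); apply: eq_recursive => x.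
by elim: (a x) => //= k ->; case: (odd k).
Qed.
#[export] Hint Resolve recursive_bool_odd : recursion.

Lemma recursive_half n (a : n.-tuple nat -> nat) :
  recursive a -> recursive (fun x => (a x)./2).
Proof.
move=> ra; have := @recursive_iteri _ a (fun=> 0) (fun k y x => odd k + y) ra.
move=> /(_ ltac:(recursion) ltac:(recursion)); apply: eq_recursive => x.
by elim: (a x) => //= k ->; rewrite uphalf_half.
Qed.
#[export] Hint Resolve recursive_half : recursion.

Lemma recursive_find n (P : nat -> n.-tuple nat -> bool) (N : n.-tuple nat -> nat) :
  recursive_bool (fun z : n.+1.-tuple nat => P (thead z) (behead_tuple z)) ->
  recursive N -> recursive (fun x => find (P^~ x) (iota 0 (N x))).
Proof.
move=> rP rN.
(* The accumulator [y] is the result of the search below [k]: [y < k] records a hit, [y = k] that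
   there was none so far. *)
have := @recursive_iteri _ N (fun=> 0)
  (fun k y x => if y < k then y else if P k x then k else k.+1) rN.
have rP' : recursive_bool (fun z : n.+2.-tuple nat =>
    P (thead z) (behead_tuple (behead_tuple z))).
  apply: (recursive_subst_thead (F := fun k x => P k x)) => // [|i].
    exact: recursive_thead.
  exact: (recursive_behead (recursive_behead (recursive_tnth i))).
move=> /(_ ltac:(recursion) ltac:(recursion)); apply: eq_recursive => x.
elim: (N x) => // k IHk; rewrite iteriS {}IHk -[in RHS]addn1 iotaD find_cat.
rewrite has_find size_iota /= add0n.
by case: ltnP => // _; case: (P k x); rewrite ?addn0 ?addn1.
Qed.
#[export] Hint Extern 2 (recursive (fun x => find _ (iota 0 _))) =>
  apply: recursive_find : recursion.

Lemma recursive_bool_has n (P : nat -> n.-tuple nat -> bool) (N : n.-tuple nat -> nat) :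
  recursive_bool (fun z : n.+1.-tuple nat => P (thead z) (behead_tuple z)) ->
  recursive N -> recursive_bool (fun x => has (P^~ x) (iota 0 (N x))).
Proof.
move=> rP rN; have rF := recursive_find rP rN.
have : recursive_bool (fun x => find (P^~ x) (iota 0 (N x)) < N x) by recursion.
by apply: eq_recursive => x; rewrite has_find size_iota.
Qed.

#[export] Hint Extern 2 (recursive_bool (fun x => has _ (iota 0 _))) =>
  apply: recursive_bool_has : recursion.

(** * Cantor pairing and its inverse *)

Lemma recursive_to_nat n (a b : n.-tuple nat -> nat) :
  recursive a -> recursive b -> recursive (fun x => Cantor.to_nat (a x, b x)).
Proof.
move=> ra rb.
(* [Cantor.to_nat (a, b)] unfolds to [b] plus the triangular number of [b + a], which this iteration
   computes. *)
have := @recursive_iteri _ (fun x => b x + a x) (fun=> 0) (fun k y x => k.+1 + y).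
move=> /(_ ltac:(recursion) ltac:(recursion) ltac:(recursion)) rS.
by have := recursive_addn rb rS.
Qed.
#[export] Hint Resolve recursive_to_nat : recursion.

Lemma leq_to_nat a b : b + a <= Cantor.to_nat (a, b).
Proof. exact/leP/Cantor.to_nat_non_decreasing. Qed.

(** Serves to invert injective codings by bounded search: a unique solution below the bound is the
    one found. *)
Lemma find_iota_eq (P : pred nat) n k :
  P k -> (forall i, P i -> i = k) -> k < n -> find P (iota 0 n) = k.
Proof.
move=> Pk uk lt_kn.
have hP : has P (iota 0 n) by apply/hasP; exists k; rewrite ?mem_iota.
have := nth_find 0 hP; rewrite nth_iota ?add0n; first exact: uk.
by rewrite -[X in _ < X](size_iota 0 n) -has_find.
Qed.

Lemma recursive_of_nat1 n (a : n.-tuple nat -> nat) :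
  recursive a -> recursive (fun x => (Cantor.of_nat (a x)).1).
Proof.
move=> ra; have : recursive (fun x => find (fun i => has
    (fun j => Cantor.to_nat (i, j) == a x) (iota 0 (a x).+1)) (iota 0 (a x).+1)).
  by recursion.
apply: eq_recursive => x; case E : (Cantor.of_nat (a x)) => [i j]; rewrite [RHS]/=.
have aE : Cantor.to_nat (i, j) = a x by rewrite -E Cantor.cancel_to_of.
have := leq_to_nat i j; rewrite aE => le_ij.
apply: find_iota_eq; last by lia.
  by apply/hasP; exists j; rewrite ?mem_iota ?aE //; lia.
by move=> i' /hasP[j' _ /eqP]; rewrite -aE => /Cantor.to_nat_inj[].
Qed.

Lemma recursive_of_nat2 n (a : n.-tuple nat -> nat) :
  recursive a -> recursive (fun x => (Cantor.of_nat (a x)).2).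
Proof.
move=> ra; have : recursive (fun x => find (fun j => has
    (fun i => Cantor.to_nat (i, j) == a x) (iota 0 (a x).+1)) (iota 0 (a x).+1)).
  by recursion.
apply: eq_recursive => x; case E : (Cantor.of_nat (a x)) => [i j]; rewrite [RHS]/=.
have aE : Cantor.to_nat (i, j) = a x by rewrite -E Cantor.cancel_to_of.
have := leq_to_nat i j; rewrite aE => le_ij.
apply: find_iota_eq; last by lia.
  by apply/hasP; exists i; rewrite ?mem_iota ?aE //; lia.
by move=> j' /hasP[i' _ /eqP]; rewrite -aE => /Cantor.to_nat_inj[].
Qed.
#[export] Hint Resolve recursive_of_nat1 recursive_of_nat2 : recursion.

(** * Recursive functions on coded words *)

Lemma code_cons_inj x c y d :
  2 ^ x * c.*2.+1 = 2 ^ y * d.*2.+1 -> x = y /\ c = d.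
Proof.
move=> eq_code.
have : CodeSeq.code (x :: CodeSeq.decode c) = CodeSeq.code (y :: CodeSeq.decode d).
  by rewrite /= !CodeSeq.decodeK.
move=> /(can_inj CodeSeq.codeK)[-> /(can_inj CodeSeq.decodeK)]; by split.
Qed.

Lemma code_cons_gt x s :
  (x < CodeSeq.code (x :: s)) && (CodeSeq.code s < CodeSeq.code (x :: s)).
Proof.
rewrite /=; have := ltn_expl x (ltnSn 1); set c := CodeSeq.code s.
by move=> lt_x2x; apply/andP; split; nia.
Qed.

(** The code of [y :: s] is [2 ^ y * (CodeSeq.code s).*2.+1] and exceeds both [y] and the code of
    [s], so a bounded search splits it. Code 0 is the empty word. *)
Lemma recursive_head n (w : n.-tuple nat -> word) :
  recursive_word w -> recursive (fun x => head 0 (w x)).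
Proof.
move=> rw; have : recursive (fun x => if CodeSeq.code (w x) == 0 then 0 else
    find (fun i => has (fun j => 2 ^ i * j.*2.+1 == CodeSeq.code (w x))
      (iota 0 (CodeSeq.code (w x)))) (iota 0 (CodeSeq.code (w x)))).
  by recursion.
apply: eq_recursive => x; case: (w x) => // y s.
have /andP[lt_y lt_s] := code_cons_gt y s.
rewrite -[_ == 0]negbK -lt0n (leq_trans _ lt_y) //=.
apply: find_iota_eq => //.
  by apply/hasP; exists (CodeSeq.code s); rewrite ?mem_iota.
by move=> i /hasP[j _ /eqP /code_cons_inj[]].
Qed.

Lemma recursive_word_behead n (w : n.-tuple nat -> word) :
  recursive_word w -> recursive_word (fun x => behead (w x)).
Proof.
move=> rw; have : recursive (fun x => if CodeSeq.code (w x) == 0 then 0 else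
    find (fun j => has (fun i => 2 ^ i * j.*2.+1 == CodeSeq.code (w x))
      (iota 0 (CodeSeq.code (w x)))) (iota 0 (CodeSeq.code (w x)))).
  by recursion.
apply: eq_recursive => x; case: (w x) => // y s.
have /andP[lt_y lt_s] := code_cons_gt y s.
rewrite -[_ == 0]negbK -lt0n (leq_trans _ lt_y) //=.
apply: find_iota_eq => //.
  by apply/hasP; exists y; rewrite ?mem_iota.
by move=> i /hasP[j _ /eqP /code_cons_inj[]].
Qed.
#[export] Hint Resolve recursive_head recursive_word_behead : recursion.

Lemma recursive_word_iteri n (N : n.-tuple nat -> nat) (g : n.-tuple nat -> word) h :
  recursive N -> recursive_word g ->
  recursive_word (fun z : n.+2.-tuple nat => h (thead z)
    (CodeSeq.decode (thead (behead_tuple z))) (behead_tuple (behead_tuple z))) ->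
  recursive_word (fun x => iteri (N x) (fun k y => h k y x) (g x)).
Proof.
move=> rN rg rh; have := recursive_iteri (h := fun k y x =>
  CodeSeq.code (h k (CodeSeq.decode y) x)) rN rg rh.
apply: eq_recursive => x; elim: (N x) => //= k ->.
by rewrite CodeSeq.codeK.
Qed.

Lemma recursive_word_drop n (N : n.-tuple nat -> nat) (w : n.-tuple nat -> word) :
  recursive N -> recursive_word w -> recursive_word (fun x => drop (N x) (w x)).
Proof.
move=> rN rw; have := @recursive_word_iteri _ N w (fun k y x => behead y) rN rw.
move=> /(_ ltac:(recursion)); apply: eq_recursive => x; congr CodeSeq.code.
by elim: (N x) => /= [|k ->]; rewrite ?drop0 // -drop1 drop_drop.
Qed.
#[export] Hint Resolve recursive_word_drop : recursion.

Lemma recursive_nth n (w : n.-tuple nat -> word) (a : n.-tuple nat -> nat) :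
  recursive_word w -> recursive a -> recursive (fun x => nth 0 (w x) (a x)).
Proof.
move=> rw ra; have : recursive (fun x => head 0 (drop (a x) (w x))) by recursion.
by apply: eq_recursive => x; rewrite -nth0 nth_drop addn0.
Qed.

Lemma size_code w : size w <= CodeSeq.code w.
Proof.
elim: w => // y s; have /andP[_] := code_cons_gt y s.
by move: (CodeSeq.code _) => c /=; lia.
Qed.

(** The size is the least [k] for which [drop k] leaves the empty word; by [size_code] the search
    can be bounded by the code. *)
Lemma recursive_size n (w : n.-tuple nat -> word) :
  recursive_word w -> recursive (fun x => size (w x)).
Proof.
move=> rw; have : recursive (fun x => find
  (fun k => CodeSeq.code (drop k (w x)) == 0) (iota 0 (CodeSeq.code (w x)).+1)).
  by recursion.
apply: eq_recursive => x; set P := fun k => _; set N := iota _ _.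
have hP : has P N.
  apply/hasP; exists (size (w x)); last by rewrite /P drop_size.
  by rewrite mem_iota /= add0n ltnS size_code.
apply/eqP; rewrite eqn_leq.
have lt_N : find P N < (CodeSeq.code (w x)).+1.
  by rewrite -[X in _ < X](size_iota 0 (CodeSeq.code (w x)).+1) -has_find.
apply/andP; split; last first.
  have := nth_find 0 hP; rewrite nth_iota // add0n /P -leqn0 => le0.
  have := leq_trans (size_code _) le0.
  by rewrite size_drop leqn0 subn_eq0.
rewrite leqNgt; apply/negP => lt_w.
have := before_find 0 lt_w; rewrite nth_iota ?add0n ?ltnS ?size_code //.
by rewrite /P drop_size.
Qed.
#[export] Hint Resolve recursive_nth recursive_size : recursion.

(** Prepending is plain arithmetic on codes, so the word is built from its last entry backwards:
    after [k] rounds it consists of the last [k] entries. *)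
Lemma recursive_word_mkseq n (F : nat -> n.-tuple nat -> nat) (N : n.-tuple nat -> nat) :
  recursive (fun z : n.+1.-tuple nat => F (thead z) (behead_tuple z)) ->
  recursive N -> recursive_word (fun x => mkseq (F^~ x) (N x)).
Proof.
move=> rF rN.
have rA : recursive (fun z : n.+2.-tuple nat =>
    N (behead_tuple (behead_tuple z)) - (thead z).+1) by recursion.
have rG : recursive (fun z : n.+2.-tuple nat =>
    F (N (behead_tuple (behead_tuple z)) - (thead z).+1)
      (behead_tuple (behead_tuple z))).
  apply: recursive_subst_thead => // i.
  exact: (recursive_behead (recursive_behead (recursive_tnth i))).
have := @recursive_word_iteri _ N (fun=> [::]) (fun k y x => F (N x - k.+1) x :: y) rN.
have rC : recursive_word (fun z : n.+2.-tuple nat =>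
  F (N (behead_tuple (behead_tuple z)) - (thead z).+1) (behead_tuple (behead_tuple z)) ::
    CodeSeq.decode (thead (behead_tuple z))).
  rewrite /recursive_word /=.
  have rD : recursive_word (fun z : n.+2.-tuple nat =>
    CodeSeq.decode (thead (behead_tuple z))) by recursion.
  apply: recursive_muln; recursion.
move=> /(_ ltac:(recursion) ltac:(recursion)); apply: eq_recursive => x.
congr CodeSeq.code.
have E k : k <= N x -> iteri k (fun k y => F (N x - k.+1) x :: y) [::]
    = map (F^~ x) (iota (N x - k) k).
  elim: k => // k IHk lt_k; rewrite iteriS IHk ?(ltnW lt_k) //=.
  by rewrite subnSK.
by rewrite E // subnn.
Qed.

#[export] Hint Extern 2 (recursive_word (fun x => mkseq _ _)) =>
  apply: recursive_word_mkseq : recursion.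

Lemma recursive_minn n (a b : n.-tuple nat -> nat) :
  recursive a -> recursive b -> recursive (fun x => minn (a x) (b x)).
Proof. by move=> ra rb; rewrite /minn; recursion. Qed.
#[export] Hint Resolve recursive_minn : recursion.

Lemma take_mkseq_nth k (w : word) : take k w = mkseq (nth 0 w) (minn k (size w)).
Proof.
apply: (@eq_from_nth _ 0) => [|i]; rewrite size_take_min ?size_mkseq // => lt_i.
by rewrite nth_mkseq // nth_take //; lia.
Qed.

Lemma recursive_word_take n (N : n.-tuple nat -> nat) (w : n.-tuple nat -> word) :
  recursive N -> recursive_word w -> recursive_word (fun x => take (N x) (w x)).
Proof.
move=> rN rw; have : recursive_word (fun x => mkseq (fun i => nth 0 (w x) i)
  (minn (N x) (size (w x)))) by recursion.
by apply: eq_recursive => x; rewrite take_mkseq_nth.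
Qed.
#[export] Hint Resolve recursive_word_take : recursion.

Lemma recursive_bool_prefix n (u v : n.-tuple nat -> word) :
  recursive_word u -> recursive_word v ->
  recursive_bool (fun x => prefix (u x) (v x)).
Proof.
move=> ru rv; have : recursive_bool (fun x =>
  CodeSeq.code (take (size (u x)) (v x)) == CodeSeq.code (u x)) by recursion.
by apply: eq_recursive => x; rewrite prefixE (can_eq CodeSeq.codeK).
Qed.

Lemma recursive_word_rcons n (w : n.-tuple nat -> word) (a : n.-tuple nat -> nat) :
  recursive_word w -> recursive a -> recursive_word (fun x => rcons (w x) (a x)).
Proof.
move=> rw ra; have : recursive_word (fun x => mkseq
  (fun i => if i < size (w x) then nth 0 (w x) i else a x) (size (w x)).+1).
  by recursion.
apply: eq_recursive => x; congr CodeSeq.code.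
apply: (@eq_from_nth _ 0) => [|i]; rewrite size_mkseq ?size_rcons // => lt_i.
rewrite nth_mkseq // nth_rcons; case: ltngtP => //; lia.
Qed.
#[export] Hint Resolve recursive_bool_prefix recursive_word_rcons : recursion.

(** * Pairing of words *)

Definition evens (w : word) : word := mkseq (fun i => nth 0 w i.*2) (size w)./2.

Definition odds (w : word) : word := mkseq (fun i => nth 0 w i.*2.+1) (size w)./2.

(** The finite counterpart of [pairing], cut at the shorter word so that no default entry is ever
    output. *)
Definition interleave (u v : word) : word :=
  mkseq (fun i => if odd i then nth 0 v i./2 else nth 0 u i./2)
    (minn (size u) (size v)).*2.

Definition even_part (x : baire) : baire := fun n => x n.*2.

Definition odd_part (x : baire) : baire := fun n => x n.*2.+1.

Lemma recursive_word_evens n (w : n.-tuple nat -> word) :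
  recursive_word w -> recursive_word (fun x => evens (w x)).
Proof. by move=> rw; rewrite /evens; recursion. Qed.

Lemma recursive_word_odds n (w : n.-tuple nat -> word) :
  recursive_word w -> recursive_word (fun x => odds (w x)).
Proof. by move=> rw; rewrite /odds; recursion. Qed.

Lemma recursive_word_interleave n (u v : n.-tuple nat -> word) :
  recursive_word u -> recursive_word v ->
  recursive_word (fun x => interleave (u x) (v x)).
Proof. by move=> ru rv; rewrite /interleave; recursion. Qed.
#[export] Hint Resolve recursive_word_evens recursive_word_odds
  recursive_word_interleave : recursion.

Lemma pairing_parts x : pairing (even_part x) (odd_part x) = x.
Proof.
apply: funext => n; rewrite /pairing /even_part /odd_part.
by case: ifPn => odd_n; congr x; have := odd_double_half n;
  rewrite ?odd_n ?(negbTE odd_n).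
Qed.

Lemma even_part_pairing q p : even_part (pairing q p) = q.
Proof. by apply: funext => n; rewrite /pairing /even_part odd_double doubleK. Qed.

Lemma odd_part_pairing q p : odd_part (pairing q p) = p.
Proof.
by apply: funext => n; rewrite /pairing /odd_part /= odd_double uphalf_double.
Qed.

Lemma pairing_inj q p q' p' : pairing q p = pairing q' p' -> q = q' /\ p = p'.
Proof.
move=> eq_x; split.
  by rewrite -(even_part_pairing q p) eq_x even_part_pairing.
by rewrite -(odd_part_pairing q p) eq_x odd_part_pairing.
Qed.

(** * Initial segments and the prefix order *)

Lemma initialP (w : word) (p : baire) :
  initial w p <-> forall i, i < size w -> nth 0 w i = p i.
Proof.
split=> [-> i|wp]; first by rewrite size_mkseq => lt_i; rewrite nth_mkseq.
by apply: (@eq_from_nth _ 0) => [|i lt_i]; rewrite ?size_mkseq // nth_mkseq // wp.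
Qed.

Lemma initial_mkseq (p : baire) n : initial (mkseq p n) p.
Proof. by rewrite /initial size_mkseq. Qed.

Lemma prefix_initial (u v : word) (p : baire) :
  prefix u v -> initial v p -> initial u p.
Proof.
case/prefixP => s -> /initialP vp; apply/initialP => i lt_i.
by rewrite -vp ?size_cat ?nth_cat ?lt_i // ltn_addr.
Qed.

Lemma prefix_nth (u v : word) :
  prefix u v <-> size u <= size v /\ initial u (nth 0 v).
Proof.
split=> [uv|[le_uv uv]].
  by split; [exact: size_prefix | apply: prefix_initial uv _; apply/initialP].
by rewrite prefixE take_mkseq_nth (minn_idPl le_uv) -uv.
Qed.

Lemma initial_prefix (u v : word) (p : baire) :
  initial u p -> initial v p -> size u <= size v -> prefix u v.
Proof.
move=> /initialP up /initialP vp le_uv; apply/prefix_nth; split=> //.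
by apply/initialP => i lt_i; rewrite up // vp // (leq_trans lt_i).
Qed.

Lemma initial_evens w p : initial w p -> initial (evens w) (even_part p).
Proof.
move=> /initialP wp; apply/initialP => i; rewrite size_mkseq => lt_i.
by rewrite nth_mkseq // wp //; lia.
Qed.

Lemma initial_odds w p : initial w p -> initial (odds w) (odd_part p).
Proof.
move=> /initialP wp; apply/initialP => i; rewrite size_mkseq => lt_i.
by rewrite nth_mkseq // wp //; lia.
Qed.

Lemma initial_interleave u v p q :
  initial u p -> initial v q -> initial (interleave u v) (pairing p q).
Proof.
move=> /initialP up /initialP vq; apply/initialP => i; rewrite size_mkseq => lt_i.
by rewrite nth_mkseq // /pairing; case: ifP => _; rewrite ?up ?vq //; lia.
Qed.

Lemma prefix_odds u v : prefix u v -> prefix (odds u) (odds v).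
Proof.
move=> uv; have [le_uv /initial_odds/initialP ini] := (prefix_nth u v).1 uv.
apply/prefix_nth; split; first by rewrite !size_mkseq; lia.
apply/initialP => i lt_i; rewrite ini //.
move: lt_i; rewrite size_mkseq => lt_i.
by rewrite nth_mkseq //; lia.
Qed.

Lemma prefix_interleave u v u' v' :
  prefix u u' -> prefix v v' -> prefix (interleave u v) (interleave u' v').
Proof.
move=> /prefix_nth[le_u iu] /prefix_nth[le_v iv].
apply/prefix_nth; split; first by rewrite !size_mkseq; lia.
have /initialP ini := initial_interleave iu iv.
apply/initialP => i lt_i; rewrite ini //.
move: lt_i; rewrite size_mkseq => lt_i.
by rewrite nth_mkseq //; lia.
Qed.

(** * Names of the lifted functions *)

Lemma recursive_graph_symbol n (u v : n.-tuple nat -> word) :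
  recursive_word u -> recursive_word v ->
  recursive (fun x => graph_symbol (u x) (v x)).
Proof. by move=> ru rv; rewrite /graph_symbol; recursion. Qed.
#[export] Hint Resolve recursive_graph_symbol : recursion.

Definition symbol_source (a : nat) : word := CodeSeq.decode (Cantor.of_nat (a - 3)).1.

Definition symbol_target (a : nat) : word := CodeSeq.decode (Cantor.of_nat (a - 3)).2.

Lemma graph_symbolK u v :
  symbol_source (graph_symbol u v) = u /\ symbol_target (graph_symbol u v) = v.
Proof.
rewrite /symbol_source /symbol_target /graph_symbol addnC addnK.
by rewrite Cantor.cancel_of_to /= !CodeSeq.codeK.
Qed.

Lemma graph_symbol_inj u v u' v' :
  graph_symbol u v = graph_symbol u' v' -> u = u' /\ v = v'.
Proof.
move=> eq_a; have [su sv] := graph_symbolK u v; have := graph_symbolK u' v'.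
by rewrite -eq_a su sv.
Qed.

(** For the dummy symbols 0, 1, 2 the truncated difference [a - 3] is 0, which decodes to a pair of
    empty words. They thus need no separate treatment where an empty target is harmless. *)
Lemma symbolP a :
  symbol_target a = [::] \/
  a = graph_symbol (symbol_source a) (symbol_target a).
Proof.
have [lt_a|le_a] := ltnP a 3.
  by left; rewrite /symbol_target (eqP (ltnW lt_a : a - 3 == 0)).
right; rewrite /graph_symbol !CodeSeq.decodeK -surjective_pairing Cantor.cancel_to_of.
by rewrite subnKC.
Qed.

(* Place in the table of symbol [j] of the name lifting any [q] with
   [j.+1]-prefix [take j.+1 w]. *)
Definition name_index (w : word) (j : nat) : nat :=
  Cantor.to_nat (CodeSeq.code (take j.+1 w), j).

(* The longest prefix of the name lifting an extension of [w] that can be read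
   in the part [T] of the table. *)
Definition name_lookup (T w : word) : word :=
  mkseq (fun j => nth 0 T (name_index w j))
    (find (fun j => size T <= name_index w j) (iota 0 (size w))).

(* Symbol [j] of the name lifting [q], where [w] is the [j.+1]-prefix of [q] and
   [T] the table so far. An even symbol stores an entry of [q]: it is harmless as
   the empty word approximates everything. An odd position codes a word [u], a
   position [i.2] in the first half of [q], and the padding. *)
Definition name_symbol (phiH phiK : word -> word) (T w : word) (j : nat) : nat :=
  if odd j then
    let i := Cantor.of_nat (Cantor.of_nat j./2).1 in
    let a := nth 0 (evens w) i.2 in
    graph_symbol (CodeSeq.decode i.1)
      (if prefix (symbol_source a) (phiH (interleave (odds w) (CodeSeq.decode i.1)))
       then interleave (name_lookup T (symbol_target a)) (phiK (odds (symbol_target a)))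
       else [::])
  else graph_symbol (CodeSeq.decode (nth 0 w j./2)) [::].

Definition table_entry phiH phiK (i : nat) (T : word) : nat :=
  name_symbol phiH phiK T (CodeSeq.decode (Cantor.of_nat i).1) (Cantor.of_nat i).2.

(** Course-of-values recursion: each entry is computed from the list of all earlier ones. *)
Definition name_table phiH phiK (n : nat) : word :=
  iteri n (fun i T => rcons T (table_entry phiH phiK i T)) [::].

Definition name_word phiH phiK (w : word) : word :=
  mkseq (fun j => table_entry phiH phiK (name_index w j)
    (name_table phiH phiK (name_index w j))) (size w).

(** The name [S q] of the overview. Symbol [j] depends only on the first [j.+1] entries of [q],
    which is why [name_word] can compute it on words. *)
Definition lifted_name phiH phiK (q : baire) : baire :=
  fun j => table_entry phiH phiK (name_index (mkseq q j.+1) j)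
    (name_table phiH phiK (name_index (mkseq q j.+1) j)).

Lemma recursive_name_index n (w : n.-tuple nat -> word) (j : n.-tuple nat -> nat) :
  recursive_word w -> recursive j -> recursive (fun x => name_index (w x) (j x)).
Proof. by move=> rw rj; rewrite /name_index; recursion. Qed.
#[export] Hint Resolve recursive_name_index : recursion.

Lemma recursive_word_name_lookup n (T w : n.-tuple nat -> word) :
  recursive_word T -> recursive_word w ->
  recursive_word (fun x => name_lookup (T x) (w x)).
Proof. by move=> rT rw; rewrite /name_lookup; recursion. Qed.
#[export] Hint Resolve recursive_word_name_lookup : recursion.

Lemma recursive_table_entry phiH phiK n (i : n.-tuple nat -> nat)
    (T : n.-tuple nat -> word) :
  computable_word_function phiH -> computable_word_function phiK ->
  recursive i -> recursive_word T ->
  recursive (fun x => table_entry phiH phiK (i x) (T x)).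
Proof.
move=> rH rK ri rT.
by rewrite /table_entry /name_symbol /symbol_source /symbol_target; recursion.
Qed.
#[export] Hint Resolve recursive_table_entry : recursion.

Lemma recursive_word_name_table phiH phiK n (N : n.-tuple nat -> nat) :
  computable_word_function phiH -> computable_word_function phiK ->
  recursive N -> recursive_word (fun x => name_table phiH phiK (N x)).
Proof.
move=> rH rK rN; apply: (@recursive_word_iteri _ N (fun=> [::])
  (fun i T x => rcons T (table_entry phiH phiK i T))) => //; recursion.
Qed.
#[export] Hint Resolve recursive_word_name_table : recursion.

Lemma recursive_word_name_word phiH phiK n (w : n.-tuple nat -> word) :
  computable_word_function phiH -> computable_word_function phiK ->
  recursive_word w -> recursive_word (fun x => name_word phiH phiK (w x)).
Proof. by move=> rH rK rw; rewrite /name_word; recursion. Qed.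
#[export] Hint Resolve recursive_word_name_word : recursion.

Lemma nth_name_table phiH phiK n i : i < n ->
  nth 0 (name_table phiH phiK n) i = table_entry phiH phiK i (name_table phiH phiK i).
Proof.
suff -> : name_table phiH phiK n =
    mkseq (fun i => table_entry phiH phiK i (name_table phiH phiK i)) n.
  exact: nth_mkseq.
by elim: n => // n IHn; rewrite mkseqS -IHn.
Qed.

Lemma size_name_table phiH phiK n : size (name_table phiH phiK n) = n.
Proof. by elim: n => // n IHn; rewrite /name_table iteriS size_rcons IHn. Qed.

Lemma name_index_initial w q j : initial w q -> j < size w ->
  name_index w j = name_index (mkseq q j.+1) j.
Proof.
move=> /initialP wq lt_j; congr (Cantor.to_nat (CodeSeq.code _, _)).
rewrite [RHS]take_oversize ?size_mkseq //.
apply: (@eq_from_nth _ 0) => [|i]; rewrite size_takel // ?size_mkseq // => lt_i.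
by rewrite nth_take // nth_mkseq // wq // (leq_trans lt_i).
Qed.

(** Makes the padding effective: symbol [j] is computed from a table of at least [j] entries, so a
    large [j] sees any prescribed finite set of entries. *)
Lemma name_index_ge w j : j <= name_index w j.
Proof. exact: leq_trans (leq_addr _ _) (leq_to_nat _ _). Qed.

Lemma initial_name_word phiH phiK w q :
  initial w q -> initial (name_word phiH phiK w) (lifted_name phiH phiK q).
Proof.
move=> wq; apply/initialP => j; rewrite size_mkseq => lt_j.
by rewrite nth_mkseq // (name_index_initial wq).
Qed.

(** A short table can only shorten what is read, never falsify it, because each place read depends
    only on a prefix of [q]. *)
Lemma initial_name_lookup phiH phiK w q n :
  initial w q ->
  initial (name_lookup (name_table phiH phiK n) w) (lifted_name phiH phiK q).
Proof.
move=> wq; apply/initialP => j; rewrite size_mkseq => lt_find.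
have lt_j : j < size w.
  by rewrite (leq_trans lt_find) // -{2}(size_iota 0 (size w)) find_size.
have := before_find 0 lt_find; rewrite nth_iota // add0n size_name_table => /negbT.
rewrite -ltnNge => lt_n.
by rewrite nth_mkseq // nth_name_table // (name_index_initial wq).
Qed.

Lemma size_name_lookup T w :
  (forall j, j < size w -> name_index w j < size T) -> size (name_lookup T w) = size w.
Proof.
move=> lt_T; rewrite size_mkseq hasNfind ?size_iota //; apply/hasPn => j.
by rewrite mem_iota -ltnNge => /lt_T.
Qed.

Lemma lifted_nameE phiH phiK q j :
  lifted_name phiH phiK q j = name_symbol phiH phiK
    (name_table phiH phiK (name_index (mkseq q j.+1) j)) (mkseq q j.+1) j.
Proof.
rewrite /lifted_name /table_entry.
have -> : Cantor.of_nat (name_index (mkseq q j.+1) j) = (CodeSeq.code (mkseq q j.+1), j).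
  by rewrite /name_index Cantor.cancel_of_to take_oversize ?size_mkseq.
by rewrite CodeSeq.codeK.
Qed.

Lemma lifted_name_even phiH phiK q n :
  lifted_name phiH phiK q n.*2 = graph_symbol (CodeSeq.decode (q n)) [::].
Proof.
rewrite lifted_nameE /name_symbol odd_double doubleK nth_mkseq //.
by rewrite ltnS -addnn leq_addr.
Qed.

Lemma sup_initial (phi : word -> word) p r w :
  is_sup (phi @` [set w | initial w p]) r -> initial w p -> initial (phi w) r.
Proof. by case=> + _ => + wp; apply; exists w. Qed.

Lemma Phi_symbol a r q' k :
  Phi a r q' -> initial (symbol_source (a k)) r -> initial (symbol_target (a k)) q'.
Proof.
move=> [ini _]; case: (symbolP (a k)) => [-> //|ak ir].
by apply: ini; exists (symbol_source (a k)) => //; exists k.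
Qed.

(** The self-referential equation for [S]: if [r] is the value of [H] at [<p, s>], [q'] that of
    [U_a] at [r] and [k] that of [K] at [p'], then [S q] sends [s] to [<S q', k>]. *)
Lemma Phi_lifted_name phiH phiK q s r q' k :
  word_monotone phiH -> word_monotone phiK ->
  is_sup (phiH @` [set w | initial w (pairing (odd_part q) s)]) r ->
  Phi (even_part q) r q' ->
  is_sup (phiK @` [set w | initial w (odd_part q')]) k ->
  Phi (lifted_name phiH phiK q) s (pairing (lifted_name phiH phiK q') k).
Proof.
move=> monoH monoK supH supq' supK; split=> [v [u us [j]]|n].
  (* Soundness: even symbols and failed prefix tests list only the empty word. *)
  rewrite lifted_nameE /name_symbol; case: ifP => _ /graph_symbol_inj[equ eqv];
    last by rewrite -eqv.
  move: eqv; rewrite equ; set w := mkseq q j.+1; have wq := initial_mkseq q j.+1.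
  case: ifP => [pre <-|_ <- //]; set i := (Cantor.of_nat _).2 in pre *.
  (* The test [pre] puts the source of the symbol inside [r], hence its target inside [q']. Beyond
     the end of [evens w] the default 0 is read, whose target is empty. *)
  have tq' : initial (symbol_target (nth 0 (evens w) i)) q'.
    have [lt_i|le_i] := ltnP i (size (evens w)); last by rewrite nth_default.
    have /initialP ew := initial_evens wq.
    rewrite ew //; apply: (Phi_symbol supq'); rewrite -ew //.
    apply: prefix_initial pre _; apply: sup_initial supH _.
    exact: initial_interleave (initial_odds wq) us.
  apply: initial_interleave; first exact: initial_name_lookup.
  by apply: sup_initial supK _; exact: initial_odds.
(* Unboundedness, with words chosen backwards from the wanted length [n]: [z] makes [phiK] long, [v]
   is twice as long as [z] and more because [odds] halves lengths, and [y] makes [phiH] cover the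
   source [u] of [v]. *)
have [_ [z zq' <-] le_nz] := supK.2 n.
have [v [u ur [i eq_i]] le_v] := supq'.2 (n + (size z).*2).
have [_ [y yps <-] le_uy] := supH.2 (size u).
pose x := mkseq s (size y).
(* The padding [N] makes [j] large enough for three things: the table used at [j] contains the
   places of all symbols looked up for [v] (the bound [M]), [evens w] reaches position [i], and
   [odds w] is at least as long as [x]. *)
pose M := \max_(j < size v) name_index v j.
pose N := M + i.*2 + (size y).*2.+2.
pose j := (Cantor.to_nat (Cantor.to_nat (CodeSeq.code x, i), N)).*2.+1.
have le_Nj : N <= j.
  have := leq_to_nat (Cantor.to_nat (CodeSeq.code x, i)) N; rewrite /j; lia.
pose w := mkseq q j.+1; have wq : initial w q := initial_mkseq q j.+1.
have vq' : initial v q' by apply: supq'.1; exists u => //; exists i.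
exists (interleave (name_lookup (name_table phiH phiK (name_index w j)) v)
  (phiK (odds v))).
  exists x; first exact: initial_mkseq.
  have odd_j : odd j by rewrite /= odd_double.
  have half_j : j./2 = Cantor.to_nat (Cantor.to_nat (CodeSeq.code x, i), N).
    exact: uphalf_double.
  exists j; rewrite lifted_nameE /name_symbol odd_j half_j !Cantor.cancel_of_to.
  rewrite CodeSeq.codeK.
  have -> : nth 0 (evens (mkseq q j.+1)) i = graph_symbol u v.
    have /initialP -> := initial_evens wq; first exact: eq_i.
    by rewrite !size_mkseq; move: le_Nj; rewrite /N; lia.
  have [-> ->] := graph_symbolK u v.
  suff -> : prefix u (phiH (interleave (odds (mkseq q j.+1)) x)) by [].
  have ini := initial_interleave (initial_odds wq) (initial_mkseq s (size y)).
  apply: (initial_prefix ur (sup_initial supH ini)).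
  apply: leq_trans le_uy _; apply: size_prefix; apply: monoH.
  apply: (initial_prefix yps ini); rewrite !size_mkseq.
  by move: le_Nj; rewrite /N; lia.
rewrite size_mkseq size_name_lookup; last first.
  move=> l lt_l; rewrite size_name_table; apply: leq_trans (name_index_ge w j).
  apply: leq_trans le_Nj; rewrite /N.
  have : name_index v l <= M by exact: (leq_bigmax (Ordinal lt_l)).
  lia.
have : n <= size (phiK (odds v)).
  apply: leq_trans le_nz _; apply: size_prefix; apply: monoK.
  apply: (initial_prefix zq' (initial_odds vq')); rewrite size_mkseq; lia.
lia.
Qed.

(** * The reduction *)

(** The lift [<S q, K p>] of a stage [q = <a, p>]; at [q0] it is the inner function of the
    reduction. *)
Definition loop_input phiH phiK (K : baire -> option baire) (q : baire) : option baire :=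
  omap (pairing (lifted_name phiH phiK q)) (K (odd_part q)).

Lemma computable_loop_input phiH phiK K :
  computable_word_function phiH -> computable_word_function phiK ->
  word_monotone phiK ->
  (forall p r, K p = Some r -> is_sup (phiK @` [set w | initial w p]) r) ->
  computable (loop_input phiH phiK K).
Proof.
move=> rH rK monoK supK.
exists (fun w => interleave (name_word phiH phiK w) (phiK (odds w))); split.
- have rt : recursive (fun x : 1.-tuple nat => thead x) by exact: recursive_thead.
  change (recursive_word (fun x : 1.-tuple nat => interleave
    (name_word phiH phiK (CodeSeq.decode (thead x)))
    (phiK (odds (CodeSeq.decode (thead x)))))).
  by recursion.
- move=> u v uv; apply: prefix_interleave; last exact/monoK/prefix_odds.
  have vv : initial v (nth 0 v) by apply/initialP.
  have uu := prefix_initial uv vv.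
  apply: (initial_prefix (initial_name_word _ _ uu) (initial_name_word _ _ vv)).
  by rewrite !size_mkseq size_prefix.
move=> q x; rewrite /loop_input; case E: (K _) => [k|] //= [<-].
have sup := supK _ _ E; split=> [_ [w wq <-]|n].
  apply: initial_interleave; first exact: initial_name_word.
  exact: sup_initial sup (initial_odds wq).
have [_ [z zp <-] le_nz] := sup.2 n.
(* The summand [n] makes [name_word] long enough; the doubled one makes [odds w] cover [z]. *)
pose w := mkseq q (n + (size z).*2); have wq : initial w q := initial_mkseq q _.
exists (interleave (name_word phiH phiK w) (phiK (odds w))); first by exists w.
rewrite !size_mkseq.
have : n <= size (phiK (odds w)).
  apply: leq_trans le_nz _; apply: size_prefix; apply: monoK.
  apply: (initial_prefix zp (initial_odds wq)); rewrite !size_mkseq; lia.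
lia.
Qed.

Definition input_of_name (a : baire) : baire :=
  fun n => CodeSeq.code (symbol_source (a n.*2)).

Lemma input_of_nameK phiH phiK : cancel (lifted_name phiH phiK) input_of_name.
Proof.
move=> q; apply: funext => n; rewrite /input_of_name lifted_name_even.
by rewrite (graph_symbolK _ _).1 CodeSeq.decodeK.
Qed.

(** Reads each stage of [f] from the even symbols of the name in the corresponding stage of [g]. No
    access to [q0] is required, which makes the reduction strong. *)
Definition loop_output (t : baire) : option baire :=
  Some (tupling (fun i => input_of_name (even_part (fun n => t (Cantor.to_nat (i, n)))))).

Lemma loop_output_tupling (x : nat -> baire) :
  loop_output (tupling x) = Some (tupling (fun i => input_of_name (even_part (x i)))).
Proof.
congr (Some (tupling _)); apply: funext => i; congr (input_of_name (even_part _)).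
by apply: funext => n; rewrite /tupling Cantor.cancel_of_to.
Qed.

Lemma computable_loop_output : computable loop_output.
Proof.
(* One doubling selects the name within the stage, the other the even symbols within the name. [L w]
   counts the outputs whose sources all lie within [w]. *)
pose idx z := Cantor.to_nat ((Cantor.of_nat z).1, (Cantor.of_nat z).2.*2.*2).
pose L (w : word) := find (fun z => size w <= idx z) (iota 0 (size w)).
pose phi w := mkseq (fun z => CodeSeq.code (symbol_source (nth 0 w (idx z)))) (L w).
have loopE t : loop_output t = Some (fun z => CodeSeq.code (symbol_source (t (idx z)))).
  congr Some; apply: funext => z; rewrite /tupling /idx /input_of_name /even_part.
  by case: (Cantor.of_nat z).
have le_L (w : word) : L w <= size w.
  by rewrite -[X in _ <= X](size_iota 0) find_size.
have lt_idx (w : word) z : z < L w -> idx z < size w.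
  move=> lt_z; have := before_find 0 lt_z; rewrite nth_iota.
    by rewrite add0n => /negbT; rewrite -ltnNge.
  exact: leq_trans lt_z (le_L w).
have ge_L (w : word) n : n <= size w -> (forall z, z < n -> idx z < size w) -> n <= L w.
  move=> le_n lt_w; rewrite leqNgt; apply/negP => lt_L.
  have hP : has (fun z => size w <= idx z) (iota 0 (size w)).
    by rewrite has_find size_iota (leq_trans lt_L).
  have := nth_find 0 hP; rewrite nth_iota; last by rewrite (leq_trans lt_L).
  by rewrite add0n leqNgt lt_w.
have ini w t : initial w t ->
    initial (phi w) (fun z => CodeSeq.code (symbol_source (t (idx z)))).
  move=> /initialP wt; apply/initialP => z; rewrite size_mkseq => lt_z.
  by rewrite nth_mkseq // wt // lt_idx.
exists phi; split.
- have rt : recursive (fun x : 1.-tuple nat => thead x) by exact: recursive_thead.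
  change (recursive_word (fun x : 1.-tuple nat => phi (CodeSeq.decode (thead x)))).
  by rewrite /phi /L /idx /symbol_source; recursion.
- move=> u v uv.
  have vv : initial v (nth 0 v) by apply/initialP.
  apply: (initial_prefix (ini _ _ (prefix_initial uv vv)) (ini _ _ vv)).
  have le_uv := size_prefix uv.
  rewrite !size_mkseq; apply: ge_L => [|z /lt_idx]; last by move/leq_trans; apply.
  exact: leq_trans (le_L u) le_uv.
move=> t _ [<-]; have := loopE t; case=> ->.
split=> [_ [w wt <-]|n]; first exact: ini.
pose w := mkseq t (n + \max_(z < n) (idx z).+1).
exists (phi w); first by exists w => //; exact: initial_mkseq.
rewrite size_mkseq; apply: ge_L; rewrite size_mkseq ?leq_addr // => z lt_z.
apply: leq_trans (leq_addl _ _).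
exact: (leq_bigmax (F := fun z : 'I_n => (idx z).+1) (Ordinal lt_z)).
Qed.

(** * Steps and runs of the loop *)

Lemma loop_stepP f q q' :
  loop_step f q q' <->
  (forall r, f (odd_part q) r -> exists s, Phi (even_part q) r s) /\
  exists2 r, f (odd_part q) r & Phi (even_part q) r q'.
Proof.
split=> [[dom_q [_ [a [p [r [qE fr ->]]]] [b [t [/pairing_inj[<- <-] Pr]]]]]|
         [dom_q [r fr Pr]]].
  rewrite {}qE even_part_pairing odd_part_pairing in dom_q *.
  split=> [s fs|]; last by exists r.
  have [|u [c [d [/pairing_inj[<- <-] Ps]]]] := dom_q (pairing a s).
    by exists a, p, s.
  by exists u.
have qE := esym (pairing_parts q).
split=> [_ [a [p [s [qE' fs ->]]]]|].
  move: qE' fs; rewrite {1}qE => /pairing_inj[<- <-] /dom_q[u Pu].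
  by exists u, (even_part q), s.
exists (pairing (even_part q) r); first by exists (even_part q), (odd_part q), r.
by exists (even_part q), r.
Qed.

Lemma loop_step_dom f q : mdom (loop_step f) q -> mdom f (odd_part q).
Proof. by case=> q' /loop_stepP[_ [r fr _]]; exists r. Qed.

(** Passes from realizers to single answers by applying the reduction to two modified realizers of
    [g]. *)
Lemma weihrauch_reducible_step (X Y Z W : representedSpace)
    (f : multifun X Y) (g : multifun Z W) (H K : baire -> option baire) :
  problem g ->
  (forall G, realizes G g -> realizes (pcomp H (pair_id (pcomp G K))) f) ->
  forall p, mdom (realizer_version f) p ->
  exists k, [/\ K p = Some k, mdom (realizer_version g) k &
    forall s, realizer_version g k s ->
      exists2 r, H (pairing p s) = Some r & realizer_version f p r].
Proof.
move=> [G0 rG0] red p [r0 [_ [y fpy _]]].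
pose dom_g : set baire := mdom (mcomp g (graph (@delta Z))).
have names_g k : mcomp g (graph (@delta Z)) k `<=` mdom (minverse (graph (@delta W))).
  by move=> w _; have [r dr] := delta_surjective w; exists r.
(* Being undefined off the domain of [g], this realizer forces [K p] to name a point of that
   domain. *)
pose G1 x := if `[< dom_g x >] then G0 x else None.
have rG1 : realizes G1 g.
  move=> x dx; have [w Gw gw] := rG0 x dx; exists w => //.
  by rewrite /pcomp /G1 asboolT.
have [y0 + _] := red _ rG1 p (ex_intro _ y fpy).
rewrite /pcomp /pair_id /=; case Kp: (K p) => [k|] //=.
rewrite {1}/G1; case: asboolP => // dk _.
exists k; split=> //.
  case: (dk) => w gw; have [s ds] := delta_surjective w.
  by exists s; split; [exact: names_g | exists w].
move=> s [_ [w gkw ds]].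
(* Answering [k] by the given [s] shows that [H] copes with every admissible answer. *)
pose G2 x := if `[< x = k >] then Some s else G0 x.
have rG2 : realizes G2 g.
  move=> x dx; rewrite /pcomp /G2; case: asboolP => [->|_]; last exact: rG0.
  by exists w.
have [y'] := red _ rG2 p (ex_intro _ y fpy).
rewrite /pcomp /pair_id /= Kp /= /G2 asboolT //=.
case: (H _) => //= r dr fy'; exists r => //.
split; last by exists y'.
by move=> t _; have [u du] := delta_surjective t; exists u.
Qed.

Lemma dependent_choice_loop f q0 : loop_dom f q0 -> exists q : nat -> baire,
  q 0 = q0 /\ forall i, loop_step f (q i) (q i.+1).
Proof.
move=> dom_q0.
have /choice[nxt nxtP] q : exists q', mdom (loop_step f) q -> loop_step f q q'.
  by have [[q' st]|ndom] := pselect (mdom (loop_step f) q); [exists q'|exists q].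
pose q i := iter i nxt q0.
have stage i : loop_stage f q0 i (q i).
  by elim: i => // i IHi; exists (q i) => //; apply: nxtP; exact: dom_q0 IHi.
by exists q; split=> // i; apply: nxtP; exact: dom_q0 (stage i).
Qed.

(** An answer [s] of [g] yields the answer [H <p, s>] of [f], hence a next stage [q']. Successors
    are assumed in the domain so that [K] converges on them and [q'] has a lift; as [Phi] is
    single-valued, every step of [g] arises in this way. *)
Lemma loop_step_input (f g : multifun baire baire) H K phiH phiK :
  word_monotone phiH -> word_monotone phiK ->
  (forall p r, H p = Some r -> is_sup (phiH @` [set w | initial w p]) r) ->
  (forall p r, K p = Some r -> is_sup (phiK @` [set w | initial w p]) r) ->
  (forall p, mdom f p -> exists k, [/\ K p = Some k, mdom g k &
    forall s, g k s -> exists2 r, H (pairing p s) = Some r & f p r]) ->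
  forall q, mdom (loop_step f) q -> loop_step f q `<=` mdom (loop_step f) ->
  exists x, [/\ loop_input phiH phiK K q = Some x, mdom (loop_step g) x &
    forall x', loop_step g x x' ->
      exists2 q', loop_step f q q' & loop_input phiH phiK K q' = Some x'].
Proof.
move=> monoH monoK supH supK red q dq dq'.
have [k [Kk [s0 gs0] redk]] := red _ (loop_step_dom dq).
have [q1 /loop_stepP[Udom _]] := dq.
pose S := lifted_name phiH phiK; exists (pairing (S q) k).
have simulate s : g k s -> exists q' x', [/\ loop_step f q q',
    loop_input phiH phiK K q' = Some x' & Phi (S q) s x'].
  move=> gs; have [r Hr fr] := redk s gs; have [q' Pr] := Udom r fr.
  have stq' : loop_step f q q' by apply/loop_stepP; split=> //; exists r.
  have [k' [Kk' _ _]] := red _ (loop_step_dom (dq' q' stq')).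
  exists q', (pairing (S q') k'); split=> //; first by rewrite /loop_input Kk'.
  exact: Phi_lifted_name (supH _ _ Hr) Pr (supK _ _ Kk').
have dom_x s : g (odd_part (pairing (S q) k)) s ->
    exists x', Phi (even_part (pairing (S q) k)) s x'.
  rewrite even_part_pairing odd_part_pairing => /simulate[q' [x' [_ _ P']]].
  by exists x'.
split; first by rewrite /loop_input Kk.
  have [q' [x' [_ _ P']]] := simulate _ gs0; exists x'; apply/loop_stepP; split=> //.
  by rewrite even_part_pairing odd_part_pairing; exists s0.
move=> x' /loop_stepP[_]; rewrite even_part_pairing odd_part_pairing => -[s gs Ps].
have [q' [x'' [stq' eq_x'' Ps'']]] := simulate s gs.
by exists q' => //; rewrite eq_x'' (Phi_single_valued Ps Ps'').
Qed.

Lemma loop_simulation f g (K : baire -> option baire) :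
  (forall q, mdom (loop_step f) q -> loop_step f q `<=` mdom (loop_step f) ->
    exists x, [/\ K q = Some x, mdom (loop_step g) x &
      forall x', loop_step g x x' -> exists2 q', loop_step f q q' & K q' = Some x']) ->
  forall q0, loop_dom f q0 -> exists x0, [/\ K q0 = Some x0, loop_dom g x0 &
    forall x : nat -> baire, x 0 = x0 -> (forall i, loop_step g (x i) (x i.+1)) ->
      exists q : nat -> baire, [/\ q 0 = q0,
        forall i, loop_step f (q i) (q i.+1) & forall i, K (q i) = Some (x i)]].
Proof.
move=> step q0 dom_q0.
have stepi i q x : loop_stage f q0 i q -> K q = Some x -> mdom (loop_step g) x /\
    forall x', loop_step g x x' -> exists2 q', loop_step f q q' & K q' = Some x'.
  move=> stq Kq; have [|x1 []] := step q (dom_q0 i q stq).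
    by move=> q' st; apply: (dom_q0 i.+1); exists q.
  by rewrite Kq => -[<-].
have [|x0 [Kq0 _ _]] := step q0 (dom_q0 0 q0 erefl).
  by move=> q' st; apply: (dom_q0 1); exists q0.
(* Every reachable stage of [g] is a lift of a reachable stage of [f]; this puts [x0] in the domain
   of the loop. *)
have stage i x : loop_stage g x0 i x -> exists2 q, loop_stage f q0 i q & K q = Some x.
  elim: i x => [x ->|i IHi x [x1 /IHi[q stq Kq] st]]; first by exists q0.
  have [_ /(_ x st)[q' stq' Kq']] := stepi i q x1 stq Kq.
  by exists q' => //; exists q.
exists x0; split=> // [i x /stage[q stq Kq]|x x_0 stx].
  by have [] := stepi i q x stq Kq.
(* The successor must lift to the given [x i.+1], so the choice depends on the index as well as on
   the stage. Off the reachable lifts the value is arbitrary. *)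
have /choice[nxt nxtP] (iq : nat * baire) : exists q',
    loop_stage f q0 iq.1 iq.2 -> K iq.2 = Some (x iq.1) ->
    loop_step f iq.2 q' /\ K q' = Some (x iq.1.+1).
  case: iq => i q /=; have [stq|nst] := pselect (loop_stage f q0 i q /\ K q = Some (x i)).
    by have [_ /(_ _ (stx i))[q' st Kq']] := stepi i q _ stq.1 stq.2; exists q'.
  by exists q => stq Kq; case: nst.
pose q i := iteri i (fun j r => nxt (j, r)) q0.
have qP i : loop_stage f q0 i (q i) /\ K (q i) = Some (x i).
  elim: i => [|i [stq Kq]]; first by rewrite x_0.
  by have [st Kq'] := nxtP (i, q i) stq Kq; split=> //; exists (q i).
exists q; split=> // i; have [stq Kq] := qP i; first by have [] := nxtP (i, q i) stq Kq.
exact: Kq.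
Qed.

Theorem proposition13 (X Y Z W : representedSpace)
    (f : multifun X Y) (g : multifun Z W) :
  problem f -> problem g ->
  weihrauch_reducible f g ->
  strongly_weihrauch_reducible (infinite_loop f) (infinite_loop g).
Proof.
move=> _ pg [H [K [[phiH [rH monoH supH]] [phiK [rK monoK supK]] red]]].
pose KK := loop_input phiH phiK K.
have sim := loop_simulation (loop_step_input monoH monoK supH supK
  (weihrauch_reducible_step pg red)).
exists loop_output, KK; split.
- exact: computable_loop_output.
- exact: computable_loop_input rH rK monoK supK.
move=> G rG q0 [_ [_ [_ [= <-] [dom_q0 _]]]].
have [x0 [KK0 dom_x0 lift]] := sim q0 dom_q0.
(* Some run from [x0] is needed to put [x0] in the domain of the loop of [g]; the run [x'] returned
   by [G] may be a different one. *)
have [x [x_0 stx]] := dependent_choice_loop dom_x0.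
have loop_x : infinite_loop g x0 (tupling x) by split=> //; exists x.
have dom_G : mdom (mcomp (infinite_loop g) (graph (@delta baireSpace))) x0.
  exists (tupling x); split=> [_ [= <-]|]; first by exists (tupling x).
  by exists x0.
have [t Gt [_ [_ [= <-] [_ [x' [x'_0 stx' tE]]]]]] := rG x0 dom_G.
have [q [q_0 stq KKq]] := lift x' x'_0 stx'.
have loop_q : infinite_loop f q0 (tupling q) by split=> //; exists q.
exists (tupling q); last first.
  by split=> [_ [= <-]|]; [exists (tupling q) | exists q0].
have Gx0 : G x0 = Some (tupling x').
  by move: Gt; rewrite /pcomp -tE; case: (G x0) => //= _ [->].
rewrite /pcomp [KK q0]KK0 /obind /oapp Gx0 loop_output_tupling.
congr (Some (tupling _)); apply: funext => i.
move: (KKq i); rewrite /loop_input; case: (K _) => //= k [<-].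
by rewrite even_part_pairing input_of_nameK.
Qed.
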